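(* There is no finite non-commutative inverse semigroup whose commuting graph has chromatic number equal to $1$.
   Context: A semigroup $S$ is an inverse semigroup if it is equipped with a unary operation $x\mapsto x^{-1}$ such that for all $x,y\in S$: $(x^{-1})^{-1}=x$, $xx^{-1}x=x$, $(xy)^{-1}=y^{-1}x^{-1}$, and $(xx^{-1})(yy^{-1})=(yy^{-1})(xx^{-1})$. Equivalently, every $x\in S$ has a unique inverse, i.e. a unique $y\in S$ with $xyx=x$ and $yxy=y$. The center of $S$ is $Z(S)=\{x\in S: xy=yx \text{ for all } y\in S\}$. The commuting graph of a finite non-commutative semigroup $S$ is the simple graph with vertex set $S\setminus Z(S)$ in which two distinct vertices $x,y$ are adjacent if and only if $xy=yx$. The chromatic number of a simple graph is the minimum number of colours needed to colour its vertices so that adjacent vertices have distinct colours. *)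

(* Defs.v *)
From HB Require Import structures.
From mathcomp Require Import all_boot.

Set Implicit Arguments.
Unset Strict Implicit.
Unset Printing Implicit Defensive.

#[short(type="finSemigroupType")]
HB.structure Definition FinSemigroup := {S of Semigroup S & Finite S}.

(* monoid.v declares x^-1 only for types that also have a unit element, so the
   inversion of an inverse semigroup needs its own operation. *)
HB.mixin Record Semigroup_isInverseSemigroup S of Semigroup S := {
  sinv : S -> S;
  sinvK : involutive sinv;
  mulsVs : forall x : S, (x * sinv x * x = x)%g;
  sinvM : forall x y : S, sinv (x * y)%g = (sinv y * sinv x)%g;
  mulsV_comm : forall x y : S, commute (x * sinv x)%g (y * sinv y)%g
}.

#[short(type="inverseSemigroupType")]
HB.structure Definition InverseSemigroup :=
  {S of Semigroup_isInverseSemigroup S & Semigroup S}.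

#[short(type="finInverseSemigroupType")]
HB.structure Definition FinInverseSemigroup :=
  {S of InverseSemigroup S & Finite S}.

Record sgraph := SGraph {
  vertex :> finType;
  adj : rel vertex;
  adj_sym : symmetric adj;
  adj_irrefl : irreflexive adj
}.

Definition proper_coloring (G : sgraph) (k : nat) (c : {ffun G -> 'I_k}) :=
  [forall x, forall y, adj x y ==> (c x != c y)].

Definition colorable (G : sgraph) (k : nat) :=
  [exists c : {ffun G -> 'I_k}, proper_coloring c].

Lemma colorable_ex (G : sgraph) : exists k, colorable G k.
Proof.
exists #|G|; apply/existsP; exists [ffun x => enum_rank x].
apply/forallP=> x; apply/forallP=> y; apply/implyP; rewrite !ffunE.
by apply: contraTneq => /enum_rank_inj ->; rewrite adj_irrefl.
Qed.

Definition chromatic_number (G : sgraph) : nat := ex_minn (colorable_ex G).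

Section CommutingGraph.

Variable S : finSemigroupType.

Definition scenter : {set S} :=
  [set x | [forall y : S, (x * y)%g == (y * x)%g]].

Definition noncentral : finType := {x : S | x \notin scenter}.

Definition commuting_adj : rel noncentral := fun x y =>
  (x != y) && ((val x * val y)%g == (val y * val x)%g).

Lemma commuting_adj_sym : symmetric commuting_adj.
Proof. by move=> x y; rewrite /commuting_adj eq_sym [X in _ && X]eq_sym. Qed.

Lemma commuting_adj_irrefl : irreflexive commuting_adj.
Proof. by move=> x; rewrite /commuting_adj eqxx. Qed.

(* If S is commutative this is the graph without vertices, whose chromatic
   number is 0. *)
Definition commuting_graph : sgraph :=
  SGraph commuting_adj_sym commuting_adj_irrefl.

End CommutingGraph.

(* Main.v *)
(* A graph of chromatic number 1 has no edges, so distinct noncentral elements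
   never commute.  Hence a noncentral x is equal to x^2 or has x^2 central.  In
   the first case x is its own inverse because idempotents commute.  In the
   second, one of x x^-1 and x^-1 x is central or they are equal, because they
   commute; centrality of x^2 then forces x x^-1 = x^-1 x, so x commutes with the
   noncentral element x^-1 and again x = x^-1.  Finally let x, y be noncommuting.
   If xy is noncentral then xy = (xy)^-1 = yx; otherwise xy and yx = (xy)^-1 are
   central, and xy = x^3 y = yx^3 = yx. *)
Require Import Defs.
From mathcomp Require Import all_boot.

Set Implicit Arguments.
Unset Strict Implicit.

Lemma chromatic_number1_edgeless (G : sgraph) (x y : G) :
  chromatic_number G = 1 -> adj x y = false.
Proof.
rewrite /chromatic_number; case: ex_minnP => k col_k _ k1; subst k.
case/existsP: col_k => c /forallP/(_ x)/forallP/(_ y).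
(* ['I_1] offers a single colour, so no edge is properly coloured. *)
by rewrite (ord1 (c x)) (ord1 (c y)) eqxx implybF => /negbTE.
Qed.

Local Open Scope group_scope.

Lemma scenterP (S : finSemigroupType) (x : S) :
  reflect (forall y : S, commute x y) (x \in scenter S).
Proof.
rewrite inE; apply: (iffP forallP) => cx y; first exact/eqP/cx.
by apply/eqP; apply: cx.
Qed.

Section InverseSemigroup.

Variable S : inverseSemigroupType.
Implicit Types x y : S.

Lemma mulVsV x : sinv x * x * sinv x = sinv x.
Proof. by have := mulsVs (sinv x); rewrite sinvK. Qed.

Lemma mulsV_Vs_comm x : commute (x * sinv x) (sinv x * x).
Proof. by have := mulsV_comm x (sinv x); rewrite sinvK. Qed.

Lemma idem_sinv x : x * x = x -> sinv x = x.
Proof.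
move=> xx; have VV : sinv x * sinv x = sinv x by rewrite -sinvM xx.
(* Of the two equal products, x x^-1 x^-1 x collapses to x and x^-1 x x x^-1 to x^-1. *)
have := mulsV_Vs_comm x; rewrite /commute !mulgA.
rewrite -(mulgA x (sinv x) (sinv x)) VV mulsVs.
by rewrite -(mulgA (sinv x) x x) xx mulVsV.
Qed.

(** Let e = x x^-1 and f = x^-1 x. As e is central, f e = f and e = x^2 x^-2. As x^2 is central, e =
    x^-2 x^2, which f fixes on the left; so f e = e. *)
Lemma central_sqr_mulsV x :
    (forall y, commute (x * x) y) -> (forall y, commute (x * sinv x) y) ->
  x * sinv x = sinv x * x.
Proof.
move=> cxx ce.
have zV : x * x * (sinv x * sinv x) = x * sinv x.
  rewrite mulgA -(mulgA x x (sinv x)) -(ce x).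
  by rewrite mulsVs.
have Vz : sinv x * sinv x * (x * x) = x * sinv x by rewrite -cxx.
have fe : sinv x * x * (x * sinv x) = sinv x * x.
  by rewrite -(mulgA (sinv x) x) -(ce x) mulsVs.
by rewrite -fe -Vz !mulgA mulVsV.
Qed.

End InverseSemigroup.

Lemma scenter_sinv (S : finInverseSemigroupType) (x : S) :
  (sinv x \in scenter S) = (x \in scenter S).
Proof.
have sub (z : S) : z \in scenter S -> sinv z \in scenter S.
  move/scenterP=> cz; apply/scenterP => y.
  by rewrite /commute -[y]sinvK -!sinvM cz.
by apply/idP/idP => /sub; rewrite ?sinvK.
Qed.

Section EdgelessCommutingGraph.

Variable S : finInverseSemigroupType.
Hypothesis comm_eq : forall x y : S,
  x \notin scenter S -> y \notin scenter S -> commute x y -> x = y.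

Lemma noncentral_sinv (x : S) : x \notin scenter S -> sinv x = x.
Proof.
move=> ncx; have ncVx : sinv x \notin scenter S by rewrite scenter_sinv.
have [/scenterP cxx|ncxx] := boolP (x * x \in scenter S); last first.
  by apply/idem_sinv/comm_eq; rewrite // /commute mulgA.
suff xV : x * sinv x = sinv x * x by apply: comm_eq.
have [/scenterP ce|nce] := boolP (x * sinv x \in scenter S).
  exact: central_sqr_mulsV.
have [/scenterP cf|ncf] := boolP (sinv x * x \in scenter S); last first.
  exact/comm_eq/mulsV_Vs_comm.
(* With x^-1 x central, the same lemma applies to x^-1, whose square is the inverse of the central
   x^2. *)
have /scenterP cVV : sinv x * sinv x \in scenter S.
  by rewrite -sinvM scenter_sinv; apply/scenterP.
have := central_sqr_mulsV cVV; rewrite sinvK => /(_ cf).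
exact: esym.
Qed.

Lemma edgeless_commutative : commutative (fun x y : S => x * y).
Proof.
move=> x y.
have [/scenterP cx|ncx] := boolP (x \in scenter S); first exact: cx.
have [/scenterP cy|ncy] := boolP (y \in scenter S); first by rewrite cy.
have xyV : sinv (x * y) = y * x by rewrite sinvM !noncentral_sinv.
have [cxy|ncxy] := boolP (x * y \in scenter S); last first.
  by rewrite -xyV noncentral_sinv.
have /scenterP cyx : y * x \in scenter S by rewrite -xyV scenter_sinv.
have xxx : x * x * x = x by rewrite -{2}(noncentral_sinv ncx) mulsVs.
move/scenterP: cxy => cxy.
(* x^3 y = (xy) x^2 = x (yx) x = (yx) x^2 = y x^3, by moving the central xy, then yx. *)
rewrite -{1}xxx -mulgA -cxy mulgA -(mulgA x y x) -cyx.
by rewrite -!mulgA (mulgA x x x) xxx.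
Qed.

End EdgelessCommutingGraph.

Theorem corollary5p5 :
  ~ exists S : finInverseSemigroupType,
      ~ commutative (fun x y : S => (x * y)%g) /\
      chromatic_number (commuting_graph S) = 1%N.
Proof.
move=> [S [ncS chi1]]; apply: ncS; apply: edgeless_commutative => x y ncx ncy cxy.
have := chromatic_number1_edgeless (Sub x ncx : commuting_graph S) (Sub y ncy) chi1.
move/negbT; rewrite /= /commuting_adj /= cxy eqxx andbT negbK => /eqP xy.
exact: (congr1 val xy).
Qed.
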